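(* Let $R$ be a commutative Noetherian ring (not necessarily local) and let $M$ be a non-zero finitely generated $R$-module. Then $\operatorname{grade} M\leq \operatorname{qpd}_R M$.
   Context: $\operatorname{grade} M:=\inf\{i\ge 0:\operatorname{Ext}^i_R(M,R)\ne 0\}$. For a complex $X$ of $R$-modules (homologically indexed), $\sup X=\sup\{i: X_i\ne 0\}$, $\inf X=\inf\{i: X_i\neq 0\}$, $\operatorname{hsup}X=\sup\{i: H_i(X)\neq 0\}$. $X$ is bounded below if $\inf X>-\infty$, and bounded if $\sup X-\inf X<\infty$. A quasi-projective resolution of $M$ is a bounded below complex $P$ of (finitely generated) projective $R$-modules such that for all $i\ge\inf P$ there exist non-negative integers $a_i$, not all zero, with $H_i(P)\cong M^{\oplus a_i}$. The quasi-projective dimension of $M\neq 0$ is $\operatorname{qpd}_R M=\inf\{\sup P-\operatorname{hsup}P : P \text{ is a bounded quasi-projective resolution of } M\}$; it is $\infty$ if $M$ has no bounded quasi-projective resolution. *)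

(* Defs.v *)
From HB Require Import structures.
From mathcomp Require Import all_boot all_order all_algebra.
From mathcomp Require Import generic_quotient ring_quotient.
From mathcomp Require Import mathcomp_extra boolp classical_sets functions.
From mathcomp Require Import constructive_ereal.

Set Implicit Arguments.
Unset Strict Implicit.
Unset Printing Implicit Defensive.

Import Order.TTheory GRing.Theory Num.Theory.
Local Open Scope classical_set_scope.
Local Open Scope ring_scope.

Section FiniteGeneration.
Variable R : comPzRingType.

Definition finitely_generated (M : lmodType R) : Prop :=
  exists (n : nat) (g : 'I_n -> M),
    forall x : M, exists c : 'I_n -> R, x = \sum_(i < n) c i *: g i.

Definition is_ideal (I : set R) : Prop :=
  [/\ I 0, forall x y, I x -> I y -> I (x + y)
    & forall a x, I x -> I (a * x)].

Definition noetherian : Prop :=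
  forall I : set R, is_ideal I ->
    exists (n : nat) (g : 'I_n -> R),
      I = [set x | exists c : 'I_n -> R, x = \sum_(i < n) c i * g i].

Definition zero_module (M : lmodType R) : Prop := forall x : M, x = 0.

Definition isomorphic (M N : lmodType R) : Prop :=
  exists f : {linear M -> N}, bijective f.

Definition projective (P : lmodType R) : Prop :=
  forall (A B : lmodType R) (g : {linear A -> B}) (f : {linear P -> B}),
    (forall b, exists a, g a = b) ->
    exists h : {linear P -> A}, forall x, g (h x) = f x.

End FiniteGeneration.

Section QuotientModule.
Variables (R : pzRingType) (V : lmodType R) (W : submodClosed V).

(* [submodClosed] does not inherit from [zmodClosed], which [Quotient.quot]
   requires. *)
Definition submod_zmod : {pred V} := [pred x | x \in W].

Lemma submod_zmod_closed : zmod_closed submod_zmod.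
Proof. exact/GRing.submod_closedB/submodClosedP. Qed.

HB.instance Definition _ := GRing.isZmodClosed.Build V submod_zmod
  submod_zmod_closed.

Definition quot_module := Quotient.quot submod_zmod.
HB.instance Definition _ := GRing.Zmodule.on quot_module.

Definition quot_proj (x : V) : quot_module :=
  \pi_(Quotient.quot submod_zmod)%qT x.

Lemma quot_projE x y : (quot_proj x = quot_proj y) <-> x - y \in W.
Proof.
rewrite /quot_proj; split=> [e|h].
  by have := Quotient.idealrBE submod_zmod x y; rewrite e eqxx.
by apply/eqP; have := Quotient.idealrBE submod_zmod x y; rewrite h => <-.
Qed.

Lemma quot_proj_surj (q : quot_module) : exists x, quot_proj x = q.
Proof. by exists (repr q); rewrite /quot_proj reprK. Qed.

Lemma quot_projD : {morph quot_proj : x y / x + y}.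
Proof. by move=> x y; rewrite /quot_proj raddfD. Qed.

Definition quot_scale (a : R) (q : quot_module) : quot_module :=
  quot_proj (a *: repr q).

Lemma quot_projZ a x : quot_proj (a *: x) = quot_scale a (quot_proj x).
Proof.
apply/quot_projE; rewrite -scalerBr rpredZ //.
by apply/quot_projE; rewrite /quot_proj reprK.
Qed.

Lemma quot_scaleA a b q : quot_scale a (quot_scale b q) = quot_scale (a * b) q.
Proof.
have [x <-] := quot_proj_surj q.
by rewrite -!quot_projZ scalerA.
Qed.

Lemma quot_scale1 : left_id 1 quot_scale.
Proof. by move=> q; have [x <-] := quot_proj_surj q; rewrite -quot_projZ scale1r. Qed.

Lemma quot_scaleDr : right_distributive quot_scale +%R.
Proof.
move=> a p q; have [x <-] := quot_proj_surj p; have [y <-] := quot_proj_surj q.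
by rewrite -quot_projD -!quot_projZ -quot_projD scalerDr.
Qed.

Lemma quot_scaleDl q : {morph quot_scale^~ q : a b / a + b}.
Proof.
move=> a b; have [x <-] := quot_proj_surj q.
by rewrite -!quot_projZ -quot_projD scalerDl.
Qed.

HB.instance Definition _ := GRing.Zmodule_isLmodule.Build R quot_module
  quot_scaleA quot_scale1 quot_scaleDr quot_scaleDl.

Lemma quot_proj_is_linear : linear quot_proj.
Proof. by move=> a x y; rewrite quot_projD quot_projZ. Qed.

HB.instance Definition _ :=
  GRing.isLinear.Build R V quot_module *:%R quot_proj quot_proj_is_linear.

End QuotientModule.

Arguments quot_proj {R V} W x.

Section Kernel.
Variables (R : pzRingType) (U V : lmodType R) (f : {linear U -> V}).

Definition in_kernel : {pred U} := [pred x | f x == 0].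

Lemma in_kernelE x : (x \in in_kernel) = (f x == 0). Proof. by []. Qed.

Lemma in_kernel_submod : submod_closed in_kernel.
Proof.
split; first by rewrite in_kernelE linear0.
by move=> a x y; rewrite !in_kernelE => /eqP fx /eqP fy; rewrite linearP fx fy scaler0 addr0.
Qed.

HB.instance Definition _ := GRing.isSubmodClosed.Build R U in_kernel
  in_kernel_submod.

Record kernel := Kernel { kernel_val :> U; _ : kernel_val \in in_kernel }.
HB.instance Definition _ := [isSub for kernel_val].
HB.instance Definition _ := [Choice of kernel by <:].
HB.instance Definition _ := [SubChoice_isSubLmodule of kernel by <:].
End Kernel.

(* This is ker g / (im f `&` ker g), i.e. ker g / im f as soon as [g \o f = 0];
   not requiring the latter keeps proofs out of the type. *)
Section Homology.
Variables (R : pzRingType) (A B C : lmodType R).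
Variables (f : {linear A -> B}) (g : {linear B -> C}).

Definition boundary : {pred kernel g} :=
  [pred z | `[< exists x, f x = val z >]].

Lemma boundaryP (z : kernel g) : reflect (exists x, f x = val z) (z \in boundary).
Proof. exact: asboolP. Qed.

Lemma boundary_submod : submod_closed boundary.
Proof.
split; first by apply/boundaryP; exists 0; rewrite !linear0.
move=> a x y /boundaryP[u fu] /boundaryP[v fv]; apply/boundaryP.
by exists (a *: u + v); rewrite linearP fu fv linearP.
Qed.

HB.instance Definition _ := GRing.isSubmodClosed.Build R (kernel g) boundary
  boundary_submod.

Definition homology : lmodType R := quot_module boundary.
End Homology.

Arguments boundary {R A B C} f g.

Section HomModule.
Variables (R : comPzRingType) (U V : lmodType R).

Definition is_linear_map : {pred U -> V} := [pred f | `[< linear f >]].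

Lemma is_linear_mapP (f : U -> V) : reflect (linear f) (f \in is_linear_map).
Proof. exact: asboolP. Qed.

Lemma is_linear_map_submod : submod_closed is_linear_map.
Proof.
split; first by apply/is_linear_mapP => a x y; rewrite scaler0 addr0.
move=> a f g /is_linear_mapP lf /is_linear_mapP lg.
apply/is_linear_mapP => b x y.
rewrite !fctE lf lg !scalerDr !scalerA [a * b]mulrC; exact: addrACA.
Qed.

HB.instance Definition _ := GRing.isSubmodClosed.Build R (U -> V)
  is_linear_map is_linear_map_submod.

Record hom_module :=
  HomModule { hom_fun :> U -> V; hom_funP : hom_fun \in is_linear_map }.
HB.instance Definition _ := [isSub for hom_fun].
HB.instance Definition _ := [Choice of hom_module by <:].
HB.instance Definition _ := [SubChoice_isSubLmodule of hom_module by <:].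

HB.instance Definition _ (f : hom_module) :=
  GRing.isLinear.Build R U V *:%R (hom_fun f) (is_linear_mapP _ (hom_funP f)).

Lemma is_linear_map_linear (f : {linear U -> V}) : (f : U -> V) \in is_linear_map.
Proof. by apply/is_linear_mapP; exact: linearP. Qed.

End HomModule.

Section Precomposition.
Variables (R : comPzRingType) (U V W : lmodType R) (d : {linear U -> V}).

Definition precomp (f : hom_module V W) : hom_module U W :=
  HomModule (is_linear_map_linear (f \o d)).

Lemma precomp_is_linear : linear precomp.
Proof. by move=> a f g; apply/val_inj/funext => x. Qed.

HB.instance Definition _ := GRing.isLinear.Build R (hom_module V W)
  (hom_module U W) *:%R precomp precomp_is_linear.

End Precomposition.

Arguments precomp {R U V} W d f.

Section HomologyTheory.
Variables (R : comPzRingType) (A B C : lmodType R).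
Variables (f : {linear A -> B}) (g : {linear B -> C}).

Lemma homology_zero :
  (forall x, g x = 0 -> exists a, f a = x) -> zero_module (homology f g).
Proof.
move=> fg q; have [[x gx] <-] := quot_proj_surj q.
rewrite -[RHS](linear0 (quot_proj (boundary f g))).
apply/quot_projE; rewrite subr0; apply/boundaryP.
by apply: fg; apply/eqP.
Qed.

Lemma homology_isomorphic (M : lmodType R) (e : {linear B -> M}) :
  (forall y, exists2 x, g x = 0 & e x = y) ->
  (forall x, g x = 0 -> e x = 0 <-> exists a, f a = x) ->
  isomorphic (homology f g) M.
Proof.
move=> esurj eker.
pose h (q : homology f g) : M := e (val (repr q)).
have hE (z : kernel g) : h (quot_proj (boundary f g) z) = e (val z).
  apply/eqP; rewrite /h -subr_eq0 -!linearB; apply/eqP.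
  have gz (y : kernel g) : g (val y) = 0 by apply/eqP; case: y.
  apply/eker; first exact: gz.
  by apply/boundaryP/quot_projE; rewrite /quot_proj reprK.
have hlin : linear h.
  move=> a p q; have [x <-] := quot_proj_surj p; have [y <-] := quot_proj_surj q.
  by rewrite -linearP !hE linearP.
pose hL : {linear homology f g -> M} :=
  HB.pack h (GRing.isLinear.Build R (homology f g) M *:%R h hlin).
exists hL.
have hsurj y : exists q, h q = y.
  have [x /eqP gx ex] := esurj y.
  by exists (quot_proj (boundary f g) (Kernel (gx : x \in in_kernel g))); rewrite hE.
have hinj : injective h.
  move=> p q pq; apply/eqP; rewrite -subr_eq0; apply/eqP.
  have : hL (p - q) = 0 by rewrite linearB /= pq subrr.
  move: (p - q) => r; have [x <-] := quot_proj_surj r.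
  rewrite /= hE => ex; rewrite -[RHS](linear0 (quot_proj (boundary f g))).
  apply/quot_projE; rewrite subr0; apply/boundaryP/eker => //.
  by apply/eqP; case: (x).
exists (fun y => projT1 (cid (hsurj y))) => [q|y] /=.
  by apply: hinj; case: cid.
by case: cid.
Qed.

End HomologyTheory.

Section Complexes.
Variable R : comPzRingType.

(* Differentials are given between all pairs of degrees and vanish unless the
   degree drops by one: this avoids the casts between [X (i + 1 - 1)] and
   [X i]. *)
Record complex := Complex {
  cpx_mod :> int -> lmodType R;
  cpx_d : forall i j : int, {linear cpx_mod i -> cpx_mod j};
  cpx_shape : forall i j, i != j + 1 -> forall x, cpx_d i j x = 0;
  cpx_dd : forall i j k x, cpx_d j k (cpx_d i j x) = 0
}.

Definition cpx_homology (X : complex) (i : int) : lmodType R :=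
  homology (cpx_d X (i + 1) i) (cpx_d X i (i - 1)).

(* [\bar int] is a complete total order, so the supremum exists for any [A]; the
   first argument is the value at the empty set. *)
Definition eint_sup (A : set int) : \bar int := supremum -oo%E (EFin @` A).
Definition eint_inf (A : set int) : \bar int := infimum +oo%E (EFin @` A).

Definition cpx_sup (X : complex) : \bar int :=
  eint_sup [set i | ~ zero_module (X i)].

Definition cpx_inf (X : complex) : \bar int :=
  eint_inf [set i | ~ zero_module (X i)].

Definition cpx_hsup (X : complex) : \bar int :=
  eint_sup [set i | ~ zero_module (cpx_homology X i)].

Definition bounded_below (X : complex) : Prop := (-oo < cpx_inf X)%E.

(* In [\bar int], -oo - (+oo) = -oo: the zero complex is bounded. *)
Definition bounded (X : complex) : Prop := (cpx_sup X - cpx_inf X < +oo)%E.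

Definition quasi_projective_resolution (M : lmodType R) (P : complex) : Prop :=
  [/\ bounded_below P,
      forall i, finitely_generated (P i) /\ projective (P i)
    & exists a : int -> nat,
        (forall i, (cpx_inf P <= i%:E)%E ->
           isomorphic (cpx_homology P i) {ffun 'I_(a i) -> M}) /\
        (exists2 i, (cpx_inf P <= i%:E)%E & a i != 0%N)].

Definition qpd (M : lmodType R) : \bar int :=
  infimum +oo%E [set n | exists P : complex,
    [/\ quasi_projective_resolution M P, bounded P
      & n = (cpx_sup P - cpx_hsup P)%E]].

(* A resolution is a complex without augmentation; F is exact away from 0 and
   H_0(F) is isomorphic to M. *)
Definition projective_resolution (M : lmodType R) (F : complex) : Prop :=
  [/\ forall i, i < 0 -> zero_module (F i),
      forall i, projective (F i),
      forall i, i != 0 -> zero_module (cpx_homology F i)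
    & isomorphic (cpx_homology F 0) M].
End Complexes.

Section FreeModule.
Variables (R : comPzRingType) (T : choiceType).

Definition fin_supp : {pred T -> R^o} :=
  [pred f | `[< exists s : seq T, forall x, x \notin s -> f x = 0 >]].

Lemma fin_suppP (f : T -> R^o) :
  reflect (exists s : seq T, forall x, x \notin s -> f x = 0) (f \in fin_supp).
Proof. exact: asboolP. Qed.

Lemma fin_supp_submod : submod_closed fin_supp.
Proof.
split; first by apply/fin_suppP; exists [::].
move=> a f g /fin_suppP[s fs] /fin_suppP[t gt]; apply/fin_suppP.
exists (s ++ t) => x; rewrite mem_cat negb_or => /andP[xs xt].
by rewrite !fctE fs // gt // scaler0 addr0.
Qed.

HB.instance Definition _ := GRing.isSubmodClosed.Build R (T -> R^o)
  fin_supp fin_supp_submod.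

Record free_module := FreeModule
  { free_fun :> T -> R^o; free_funP : free_fun \in fin_supp }.
HB.instance Definition _ := [isSub for free_fun].
HB.instance Definition _ := [Choice of free_module by <:].
HB.instance Definition _ := [SubChoice_isSubLmodule of free_module by <:].

Lemma free_gen_subproof (x : T) :
  (fun y => (y == x)%:R : R^o) \in fin_supp.
Proof.
by apply/fin_suppP; exists [:: x] => y; rewrite inE => /negPf ->.
Qed.

Definition free_gen (x : T) : free_module := FreeModule (free_gen_subproof x).

Definition free_supp (f : free_module) : seq T :=
  undup (projT1 (cid (fin_suppP _ (free_funP f)))).

Lemma free_suppP (f : free_module) x : x \notin free_supp f -> f x = 0.
Proof.
rewrite mem_undup => h; exact: (projT2 (cid (fin_suppP _ (free_funP f)))).
Qed.

Section Lift.
Variables (V : lmodType R) (phi : T -> V).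

Definition free_lift_fun (f : free_module) : V :=
  \sum_(x <- free_supp f) (f x : R) *: phi x.

Lemma free_lift_funE (f : free_module) (s : seq T) : uniq s ->
  (forall x, x \notin s -> f x = 0) ->
  free_lift_fun f = \sum_(x <- s) (f x : R) *: phi x.
Proof.
move=> us fs; rewrite /free_lift_fun.
rewrite (bigID (fun x => f x == 0)) /= big1 ?add0r; last first.
  by move=> x /eqP ->; rewrite scale0r.
rewrite [RHS](bigID (fun x => f x == 0)) /= [X in _ = X + _]big1 ?add0r; last first.
  by move=> x /eqP ->; rewrite scale0r.
rewrite -big_filter -[RHS]big_filter; apply: perm_big; apply: uniq_perm.
- by rewrite filter_uniq // undup_uniq.
- by rewrite filter_uniq.
move=> x; rewrite !mem_filter; case: eqVneq => //= fx.
have -> : x \in s by apply: contra_neqT fx => /fs.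
by apply: contra_neqT fx => /free_suppP.
Qed.

Lemma free_lift_is_linear : linear free_lift_fun.
Proof.
move=> a f g.
set s := undup (free_supp f ++ free_supp g).
have us : uniq s by exact: undup_uniq.
have hf x : x \notin s -> f x = 0.
  by rewrite mem_undup mem_cat negb_or => /andP[/free_suppP].
have hg x : x \notin s -> g x = 0.
  by rewrite mem_undup mem_cat negb_or => /andP[_ /free_suppP].
rewrite !(@free_lift_funE _ s) //; last first.
  by move=> x xs; rewrite /= fctE /= fctE hf // hg // scaler0 addr0.
rewrite scaler_sumr -big_split; apply: eq_bigr => x _ /=.
by rewrite scalerA -scalerDl.
Qed.

HB.instance Definition _ :=
  GRing.isLinear.Build R free_module V *:%R free_lift_fun free_lift_is_linear.

Definition free_lift : {linear free_module -> V} := free_lift_fun.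

Lemma free_lift_gen x : free_lift (free_gen x) = phi x.
Proof.
rewrite /free_lift /= (@free_lift_funE _ [:: x]) //; last first.
  by move=> y; rewrite inE /= => /negPf ->.
by rewrite big_seq1 /= eqxx scale1r.
Qed.

End Lift.

Lemma free_expand (f : free_module) :
  f = \sum_(x <- free_supp f) (f x : R) *: free_gen x.
Proof.
apply: val_inj; rewrite raddf_sum /=; apply/funext => y.
rewrite fct_sumE.
under eq_bigr do rewrite /= fctE /=.
case: (boolP (y \in free_supp f)) => [ys|ys]; last first.
  rewrite (free_suppP ys) big1_seq // => x /= xs.
  case: eqP => [yx|_]; first by rewrite yx xs in ys.
  by rewrite scaler0.
rewrite (bigD1_seq y) ?undup_uniq //= eqxx big1 ?addr0.
  by rewrite /GRing.scale /= mulr1.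
by move=> x; rewrite eq_sym => /negPf ->; rewrite scaler0.
Qed.

Lemma free_lift_unique (V : lmodType R) (h : {linear free_module -> V}) f :
  h f = free_lift (fun x => h (free_gen x)) f.
Proof.
rewrite [in LHS](free_expand f) linear_sum /free_lift /= /free_lift_fun.
by under eq_bigr do rewrite linearZ.
Qed.

Lemma free_projective : projective (free_module : lmodType R).
Proof.
move=> A B g f gsurj.
pose h := free_lift (fun x => projT1 (cid (gsurj (f (free_gen x))))).
exists h => z; rewrite (free_lift_unique f) -[g (h z)]/((g \o h) z).
rewrite (free_lift_unique (g \o h)); congr (free_lift _ z).
by apply/funext => x /=; rewrite free_lift_gen; case: cid.
Qed.

End FreeModule.

Section FreeResolution.
Variables (R : comPzRingType) (M : lmodType R).

Definition free_cover (K : lmodType R) : {linear free_module R K -> K} :=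
  free_lift (fun x : K => x).

Lemma free_cover_surj (K : lmodType R) (x : K) : exists z, free_cover K z = x.
Proof. by exists (free_gen R x); rewrite /free_cover free_lift_gen. Qed.

Fixpoint syzygy (n : nat) : lmodType R :=
  if n is m.+1 then kernel (free_cover (syzygy m)) else M.

Definition res_mod (i : int) : lmodType R :=
  if i is Posz n then free_module R (syzygy n) else {ffun 'I_0 -> R^o}.

Definition res_diff (n : nat) : {linear res_mod n.+1 -> res_mod n} :=
  (val : kernel (free_cover (syzygy n)) -> free_module R (syzygy n))
    \o free_cover (syzygy n.+1).

Definition res_d (i j : int) : {linear res_mod i -> res_mod j} :=
  match i, j with
  | Posz n.+1, Posz m =>
      if n =P m is ReflectT e
      then ecast m {linear res_mod n.+1 -> res_mod m} e (res_diff n)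
      else \0
  | _, _ => \0
  end.

Lemma res_dE n : res_d n.+1 n =1 res_diff n.
Proof.
by move=> x; rewrite /res_d /=; case: eqP => // e; rewrite eq_axiomK.
Qed.

Lemma res_shape i j : i != j + 1 -> forall x, res_d i j x = 0.
Proof.
case: i => [[|n]|n] //; case: j => [m|m] //= /eqP nm x.
by case: eqP => // e; case: nm; rewrite e -addn1.
Qed.

Lemma res_diff_ker n x :
  res_diff n x = 0 <-> free_cover (syzygy n.+1) x = 0.
Proof.
by split=> [h|h]; [apply: val_inj | rewrite /res_diff /= h].
Qed.

Lemma res_dd i j k x : res_d j k (res_d i j x) = 0.
Proof.
case: (eqVneq j (k + 1)) => [jk|/res_shape -> //].
case: (eqVneq i (j + 1)) => [ij|/res_shape ->]; last by rewrite linear0.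
case: k jk => [n|n] jk; last by case: j jk {ij} x => [[|?]|?].
have {}jk : j = n.+1 by rewrite jk -addn1.
have {}ij : i = n.+2 by rewrite ij jk -(addn1 n.+1).
subst i j; rewrite !res_dE; apply/res_diff_ker.
by rewrite /res_diff /=; apply/eqP; exact: (valP (free_cover (syzygy n.+2) x)).
Qed.

Definition free_resolution : complex R := Complex res_shape res_dd.

Lemma free_resolution_homology (P : lmodType R -> Prop) (i j k : int) :
  j = i + 1 -> k = i - 1 ->
  P (homology (res_d j i) (res_d i k)) -> P (cpx_homology free_resolution i).
Proof. by move=> -> ->. Qed.

Lemma res_diff_im n (z : free_module R (syzygy n)) :
  free_cover (syzygy n) z = 0 <-> exists x, res_d n.+1 n x = z.
Proof.
split=> [/eqP zK|[x <-]]; last first.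
  by rewrite res_dE; apply/eqP; exact: (valP (free_cover (syzygy n.+1) x)).
have [x xE] := free_cover_surj
  (Kernel (zK : z \in in_kernel (free_cover (syzygy n))) : syzygy n.+1).
by exists x; rewrite res_dE /res_diff /= xE.
Qed.

Lemma free_resolutionP : projective_resolution M free_resolution.
Proof.
have ffun0 (x : {ffun 'I_0 -> R^o}) : x = 0 by apply/ffunP; case.
split.
- by case=> [n|n] //= _ x; exact: ffun0.
- case=> [n|n] /=; first exact: free_projective.
  move=> A B g f gsurj; exists \0 => x /=.
  by rewrite (ffun0 x) !linear0.
- case=> [[|n]|n] // _.
  + apply: (@free_resolution_homology (@zero_module R) n.+1 n.+2 n).
    * by rewrite -[RHS]/(Posz (n.+1 + 1)) addn1.
    * by rewrite -addn1 PoszD addrK.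
    apply: homology_zero => x; rewrite res_dE => /res_diff_ker.
    by move/res_diff_im.
  + apply: homology_zero => x _; exists 0; rewrite linear0.
    exact/esym/ffun0.
- apply: (@free_resolution_homology (fun H => isomorphic H M) 0 1 (-1)) => //.
  apply: (homology_isomorphic (e := free_cover M)) => [y|x _].
    by have [x xy] := free_cover_surj y; exists x.
  exact: (@res_diff_im 0).
Qed.

End FreeResolution.

Section Grade.
Variable R : comPzRingType.

Lemma projective_resolution_exists (M : lmodType R) :
  exists F : complex R, projective_resolution M F.
Proof. by exists (free_resolution M); exact: free_resolutionP. Qed.

Definition proj_res (M : lmodType R) : complex R :=
  projT1 (cid (projective_resolution_exists M)).

Lemma proj_resP (M : lmodType R) : projective_resolution M (proj_res M).
Proof. exact: (projT2 (cid (projective_resolution_exists M))). Qed.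

(* The i-th cohomology of Hom(F, N) for the chosen projective resolution F of M;
   up to isomorphism it does not depend on the choice. *)
Definition Ext (i : nat) (M N : lmodType R) : lmodType R :=
  let F := proj_res M in
  homology (precomp N (cpx_d F i%:Z (i%:Z - 1)))
           (precomp N (cpx_d F (i%:Z + 1) i%:Z)).

Definition grade (M : lmodType R) : \bar int :=
  eint_inf [set i%:Z | i in [set i : nat | ~ zero_module (Ext i M R^o)]].
End Grade.

(* Main.v *)
Require Import Defs.
From HB Require Import structures.
From mathcomp Require Import all_boot all_order all_algebra.
From mathcomp Require Import boolp classical_sets functions.
From mathcomp Require Import constructive_ereal.
From mathcomp Require Import zify.

(* Let P be a bounded quasi-projective resolution of M, h = hsup P,
   n = sup P - h, and F a projective resolution of M.  An embedding of M into
   H_h(P) lifts to a map F_0 -> P_h, which extends to a chain map F -> P[h]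
   because P is exact above h.  If Ext^i(M, R) = 0 for all i <= n, then
   Ext^i(M, P_j) = 0 for these i since P_j is a summand of a finite free module;
   as P vanishes above h + n, descending induction makes the chain map
   null-homotopic.  So M embeds into H_h(P) by the zero map, i.e. M = 0. *)

Set Implicit Arguments.
Unset Strict Implicit.
Unset Printing Implicit Defensive.

Import Order.TTheory GRing.Theory Num.Theory.
Local Open Scope classical_set_scope.
Local Open Scope ring_scope.

(** * Suprema and infima of sets of integers in the extended integers *)

Section Integers.
Implicit Types A : set int.

Lemma int_bounded_max A : A !=set0 -> ubound A !=set0 ->
  exists2 h, A h & ubound A h.
Proof.
move=> [a Aa] [s As].
pose p n := `[< A (a + n%:Z) >].
have pn : exists n, p n by exists 0%N; apply/asboolP; rewrite addr0.
have ps n : p n -> (n <= `|s - a|)%N by move=> /asboolP/As; lia.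
have [n /asboolP An nmax] := ex_maxnP pn ps.
exists (a + n%:Z) => // i Ai.
have [ai|] := leP a i; last by lia.
have -> : i = a + `|i - a|%N%:Z by lia.
by rewrite lerD2l lez_nat; apply/nmax/asboolP; have -> : a + `|i - a|%N%:Z = i by lia.
Qed.

Lemma int_bounded_min A : A !=set0 -> lbound A !=set0 ->
  exists2 h, A h & lbound A h.
Proof.
move=> [a Aa] [s As].
have [||h /= Ah hmax] := @int_bounded_max [set i | A (- i)].
- by exists (- a); rewrite /= opprK.
- by exists (- s) => i /= /As; lia.
exists (- h) => // i Ai.
suff : - i <= h by lia.
by apply: hmax; rewrite /= opprK.
Qed.

(** For nonempty [A], [supremum] is a choice from [supremums], so a supremum must be exhibited: the
    maximum if [A] is bounded above, [+oo] otherwise. *)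
Lemma eint_supP A : supremums (EFin @` A) (eint_sup A).
Proof.
rewrite /eint_sup /supremum; case: ifPn => [/eqP ->|/set0P[_ [a Aa _]]].
  by split=> // y _; exact: leNye.
suff ne : supremums (EFin @` A) !=set0 by exact: (xgetPex _ ne).
have [ubA|nubA] := pselect (ubound A !=set0).
  have [||h Ah hmax] := @int_bounded_max A => //; first by exists a.
  exists h%:E; split=> [_ [i Ai <-]|y yub]; first by rewrite lee_fin hmax.
  by apply: yub; exists h.
exists +oo%E; split=> [y _|y]; first exact: leey.
case: y => [y| |] yub //.
  by case: nubA; exists y => i Ai; rewrite -lee_fin; apply: yub; exists i.
suff : (a%:E <= -oo :> \bar int)%E by [].
by apply: yub; exists a.
Qed.

Lemma eint_infP A : infimums (EFin @` A) (eint_inf A).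
Proof.
rewrite /eint_inf /infimum; case: ifPn => [/eqP ->|/set0P[_ [a Aa _]]].
  by split=> // y _; exact: leey.
suff ne : infimums (EFin @` A) !=set0 by exact: (xgetPex _ ne).
have [lbA|nlbA] := pselect (lbound A !=set0).
  have [||h Ah hmin] := @int_bounded_min A => //; first by exists a.
  exists h%:E; split=> [_ [i Ai <-]|y ylb]; first by rewrite lee_fin hmin.
  by apply: ylb; exists h.
exists -oo%E; split=> [y _|y]; first exact: leNye.
case: y => [y| |] ylb //.
  by case: nlbA; exists y => i Ai; rewrite -lee_fin; apply: ylb; exists i.
suff : (+oo <= a%:E :> \bar int)%E by [].
by apply: ylb; exists a.
Qed.

Lemma eint_sup_ge A i : A i -> (i%:E <= eint_sup A)%E.
Proof. by move=> Ai; apply: (eint_supP A).1; exists i. Qed.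

Lemma eint_inf_le A i : A i -> (eint_inf A <= i%:E)%E.
Proof. by move=> Ai; apply: (eint_infP A).1; exists i. Qed.

Lemma eint_sup_max A h : A h -> ubound A h -> eint_sup A = h%:E.
Proof.
move=> Ah hmax; apply/eqP; rewrite eq_le eint_sup_ge // andbT.
by apply: (eint_supP A).2 => _ [i Ai <-]; rewrite lee_fin hmax.
Qed.

End Integers.

(** [infimum] falls back on [x0] when [A] is empty or has no infimum; hence the bound on [x0]. *)
Lemma infimum_ge d (T : porderType d) (x x0 : T) (A : set T) :
  lbound A x -> (x <= x0)%O -> (x <= infimum x0 A)%O.
Proof.
move=> xA xx0; rewrite /infimum; case: ifP => // _.
by case: xgetP => // y _ [_]; exact.
Qed.

(** * Lifting from projective modules and embedding into powers *)

Section Modules.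
Variable R : comPzRingType.
Implicit Types M N A B C P : lmodType R.

Lemma isomorphic_sym M N : isomorphic M N -> isomorphic N M.
Proof.
move=> [f [g fK gK]].
have glin : linear g := can2_linear fK gK.
pose gL : {linear N -> M} := HB.pack g (GRing.isLinear.Build R N M *:%R g glin).
by exists gL; exists f.
Qed.

Lemma isomorphic_zero M N : isomorphic M N -> zero_module N -> zero_module M.
Proof. by move=> [f [g fK _]] N0 x; rewrite -[x]fK (N0 (f x)) -(linear0 f) fK. Qed.

Lemma quot_proj_eq0 (V : lmodType R) (W : submodClosed V) x :
  quot_proj W x = 0 <-> x \in W.
Proof. by rewrite -(linear0 (quot_proj W)) quot_projE subr0. Qed.

Lemma homology_exact A B C (f : {linear A -> B}) (g : {linear B -> C}) x :
  zero_module (homology f g) -> g x = 0 -> exists a, f a = x.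
Proof.
move=> H0 /eqP gx.
pose z : kernel g := Kernel (gx : x \in in_kernel g).
by have /quot_proj_eq0/boundaryP := H0 (quot_proj (boundary f g) z).
Qed.

Lemma homology_target_zero A B C (f : {linear A -> B}) (g : {linear B -> C}) :
  zero_module B -> zero_module (homology f g).
Proof. by move=> B0; apply: homology_zero => x _; exists 0; rewrite linear0 (B0 x). Qed.

(* The fibre product of [A] and [P] over [B] surjects onto [P]. *)
Lemma projective_lift A B P (g : {linear A -> B}) (f : {linear P -> B}) :
  projective P -> (forall x, exists a, g a = f x) ->
  exists h : {linear P -> A}, forall x, g (h x) = f x.
Proof.
move=> Pproj gf.
pose u : {linear (A * P)%type -> B} := (g \o fst) \- (f \o snd).
pose v : {linear kernel u -> P} := snd \o (val : kernel u -> _).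
have [x|h hE] := Pproj _ _ v (idfun : {linear P -> P}) _.
  have [a gax] := gf x.
  have ax : (a, x) \in in_kernel u by rewrite in_kernelE /u /= gax subrr.
  by exists (Kernel ax).
exists (fst \o ((val : kernel u -> _) \o h)) => x /=.
have /eqP := valP (h x); rewrite /u /= => /eqP.
by rewrite subr_eq0 => /eqP ->; have := hE x => /= ->.
Qed.

(** The diagonal map from [M] to its [k]-th power is injective for [k > 0], and [k = 0] would make
    [N] zero. *)
Lemma isomorphic_power_embedding M N k :
  ~ zero_module N -> isomorphic N {ffun 'I_k -> M} ->
  exists f : {linear M -> N}, injective f.
Proof.
move=> Nn0 NM; case: k NM => [|k] NM.
  by case: Nn0; apply: (isomorphic_zero NM) => x; apply/ffunP; case.
have [g gbij] := isomorphic_sym NM.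
pose c (x : M) : {ffun 'I_k.+1 -> M} := [ffun=> x].
have clin : linear c by move=> a x y; apply/ffunP => i; rewrite !ffunE.
pose cL : {linear M -> {ffun 'I_k.+1 -> M}} :=
  HB.pack c (GRing.isLinear.Build R _ _ *:%R c clin).
exists (g \o cL) => x y /= /(bij_inj gbij) /ffunP/(_ ord0).
by rewrite !ffunE.
Qed.

End Modules.

(** * Exactness of Hom complexes, null-homotopies and non-vanishing of Ext *)

Section Complexes.
Variable R : comPzRingType.
Implicit Types (F P : complex R) (M N : lmodType R).

(** The degrees are variables tied by equations, which avoids casts between [i - 1 + 1] and [i]. *)
Lemma cpx_exact P (l i k : int) x : l = i + 1 -> i = k + 1 ->
  zero_module (cpx_homology P i) -> cpx_d P i k x = 0 ->
  exists y, cpx_d P l i y = x.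
Proof.
by move=> -> /eqP; rewrite -subr_eq => /eqP <-; exact: homology_exact.
Qed.

(* Exactness of [Hom(F, N)] in degree [i]. *)
Definition cochain_exact F N (i : int) : Prop :=
  forall k l, l = i + 1 -> i = k + 1 -> forall f : {linear F i -> N},
    (forall x, f (cpx_d F l i x) = 0) ->
    exists g : {linear F k -> N}, forall x, f x = g (cpx_d F i k x).

Lemma Ext_cochain_exact M N (i : nat) :
  zero_module (Ext i M N) -> cochain_exact (proj_res M) N i.
Proof.
move=> E0 k l -> /eqP; rewrite -subr_eq => /eqP <- f f0.
have [|g gE] := homology_exact (x := HomModule (is_linear_map_linear f)) E0.
  by apply/val_inj/funext => x /=; exact: f0.
by exists g => x; have /(congr1 (fun h => hom_fun h x)) := gE.
Qed.

(** [N] is a retract of a finite power of [R]: a cocycle with values in [N] is a coboundary in each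
    coordinate, and the retraction brings the result back to [N]. *)
Lemma cochain_exact_projective F N i : finitely_generated N -> projective N ->
  cochain_exact F R^o i -> cochain_exact F N i.
Proof.
move=> [m [e eN]] Nproj ex k l li ik f f0.
pose c (v : {ffun 'I_m -> R^o}) : N := \sum_j (v j : R) *: e j.
have clin : linear c.
  move=> a v w; rewrite /c scaler_sumr -big_split; apply: eq_bigr => j _ /=.
  by rewrite !ffunE scalerDl scalerA.
pose cL : {linear {ffun 'I_m -> R^o} -> N} :=
  HB.pack c (GRing.isLinear.Build R _ _ *:%R c clin).
have [y|s sE] := Nproj _ _ cL (idfun : {linear N -> N}) _.
  have [b ->] := eN y; exists [ffun j => b j].
  by rewrite /= /c; apply: eq_bigr => j _; rewrite ffunE.
have pr_lin j : linear (fun v : {ffun 'I_m -> R^o} => v j).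
  by move=> a v w; rewrite !ffunE.
pose pr j : {linear {ffun 'I_m -> R^o} -> R^o} :=
  HB.pack (fun v : {ffun 'I_m -> R^o} => v j)
    (GRing.isLinear.Build R _ _ *:%R _ (pr_lin j)).
have exj j : exists g : {linear F k -> R^o},
    forall x, (s (f x)) j = g (cpx_d F i k x).
  apply: (ex k l li ik (pr j \o (s \o f))) => x /=.
  by rewrite f0 linear0 ffunE.
have [g gE] := choice exj.
pose h (z : F k) : {ffun 'I_m -> R^o} := [ffun j => g j z].
have hlin : linear h.
  by move=> a v w; apply/ffunP => j; rewrite !ffunE linearP.
pose hL : {linear F k -> {ffun 'I_m -> R^o}} :=
  HB.pack h (GRing.isLinear.Build R _ _ *:%R h hlin).
exists (cL \o hL) => x; rewrite -[LHS](sE (f x)) /=; congr c.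
by apply/ffunP => j; rewrite gE ffunE.
Qed.

(* [f] need not be part of a chain map [F -> P[m - j]] given in advance: each
   step lifts [f \o d] to degree [j + 1], and the recursion stops where [P]
   vanishes.  The conclusion is the null-homotopy at [j]. *)
Lemma cochain_exact_null_homotopy F P (h n : int) :
  (forall i, projective (F i)) ->
  (forall i, h < i -> zero_module (cpx_homology P i)) ->
  (forall i, h + n < i -> zero_module (P i)) ->
  (forall i j : int, 0 <= j -> j <= n -> cochain_exact F (P i) j) ->
  forall (r : nat) (k j l m q : int),
  0 <= j -> j + r%:Z = n -> m = h + j ->
  l = j + 1 -> j = k + 1 -> q = m + 1 ->
  forall f : {linear F j -> P m},
  (forall x, exists y, cpx_d P q m y = f (cpx_d F l j x)) ->
  exists (g : {linear F k -> P m}) (t : {linear F j -> P q}),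
    forall x, f x = g (cpx_d F j k x) + cpx_d P q m (t x).
Proof.
move=> Fproj Pexact Pzero Fexact.
elim=> [|r IH] k j l m q j0 jn mh lj jk qm f fd.
  (* Here [j = n], so [q = h + n + 1] is a degree where [P] vanishes; thus [f] is itself a
     cocycle. *)
  have [|x|g gE] := Fexact m j j0 _ k l lj jk f; first by lia.
    have [y <-] := fd x; rewrite (_ : y = 0) ?linear0 //.
    by apply: Pzero; lia.
  by exists g, \0 => x /=; rewrite linear0 addr0.
have [f' f'E] := projective_lift (f := f \o cpx_d F l j) (Fproj l) fd.
(* The lift [f'] satisfies the hypothesis in degree [j + 1]: [d f' d = f d d = 0], and [P] is exact
   at [q > h]. *)
have [||||||x|g [t gE]] := IH j l (l + 1) q (q + 1) _ _ _ _ _ _ f'; try lia.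
  apply: (cpx_exact erefl qm); first by apply: Pexact; lia.
  by rewrite f'E /= cpx_dd linear0.
(* Since [f d = d f' = d (g d + d t) = d g d], the difference [f - d g] is a cocycle. *)
have [|x|g' g'E] := Fexact m j j0 _ k l lj jk (f \- (cpx_d P q m \o g)) _.
- by lia.
- have := f'E x; rewrite gE linearD cpx_dd addr0 /= => ->.
  by rewrite subrr.
by exists g', g => x; rewrite -g'E /= subrK.
Qed.

Lemma Ext_nonvanishing M P (h n : int) :
  ~ zero_module M ->
  (forall i, finitely_generated (P i) /\ projective (P i)) ->
  (forall i, h < i -> zero_module (cpx_homology P i)) ->
  (forall i, h + n < i -> zero_module (P i)) ->
  0 <= n ->
  (exists f : {linear M -> cpx_homology P h}, injective f) ->
  exists2 i : nat, i%:Z <= n & ~ zero_module (Ext i M R^o).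
Proof.
move=> Mn0 Pproj Pexact Pzero n0 [f finj]; apply: contra_notP Mn0 => noExt.
have Fexact (i j : int) : 0 <= j -> j <= n -> cochain_exact (proj_res M) (P i) j.
  case: j => // j _ jn; have [Pfg Pp] := Pproj i.
  apply: cochain_exact_projective => //; apply: Ext_cochain_exact.
  by apply: contra_notP noExt => Ej; exists j.
have [Fneg Fproj _ [e ebij]] := proj_resP M.
set F := proj_res M in Fexact Fneg Fproj e ebij *.
have F0 (x : F (0 - 1)) : x = 0 by exact: Fneg.
(* As [F] vanishes in degree -1, all of [F 0] consists of cycles; [k] is the resulting inverse of
   the inclusion of the kernel. *)
have [x|k kE] := @projective_lift _ _ _ _
  (val : {linear kernel (cpx_d F 0 (0 - 1)) -> F 0}) idfun (Fproj 0) _.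
  have x0 : x \in in_kernel (cpx_d F 0 (0 - 1)) by apply/eqP; exact: F0.
  by exists (Kernel x0).
pose p : {linear F 0 -> cpx_homology P h} := f \o (e \o
  (quot_proj (boundary (cpx_d F (0 + 1) 0) (cpx_d F 0 (0 - 1))) \o k)).
have [x|u uE] := @projective_lift _ _ _ _
   (quot_proj (boundary (cpx_d P (h + 1) h) (cpx_d P h (h - 1)))) p (Fproj 0) _.
  exact: quot_proj_surj.
have [||||||x|g [t gE]] := @cochain_exact_null_homotopy F P h n Fproj Pexact
  Pzero Fexact `|n|%N (0 - 1) 0 (0 + 1) h (h + 1) _ _ _ _ _ _
  ((val : {linear kernel (cpx_d P h (h - 1)) -> P h}) \o u); try lia.
  apply/boundaryP/quot_proj_eq0; rewrite uE /p /=.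
  suff -> : quot_proj (boundary (cpx_d F (0 + 1) 0) (cpx_d F 0 (0 - 1)))
      (k (cpx_d F (0 + 1) 0 x)) = 0 by rewrite !linear0.
  by apply/quot_proj_eq0/boundaryP; exists x; rewrite -[LHS]kE.
(* In degree 0 the term of the homotopy through [F (0 - 1)] is zero, so [u] takes values in
   boundaries. *)
have p0 x : p x = 0.
  rewrite -uE; apply/quot_proj_eq0/boundaryP; exists (t x).
  by have /= -> := gE x; rewrite (F0 (cpx_d F _ _ x)) linear0 add0r.
(* Each [y] in [M] comes from some [z] in [F 0], so [f y] is a value of [p], hence zero. *)
move=> y; have [e' _ e'K] := ebij; rewrite -[y]e'K.
have [z <-] := quot_proj_surj (e' y).
have zk : z = k (val z) by apply: val_inj; rewrite -[LHS]kE.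
by apply: finj; rewrite linear0 zk; exact: p0.
Qed.

(** The nonzero term excludes [-oo] and makes the infimum finite, so a supremum [+oo] would
    contradict boundedness. *)
Lemma bounded_cpx_sup P i : ~ zero_module (P i) -> bounded_below P ->
  bounded P -> exists s : int, cpx_sup P = s%:E.
Proof.
move=> Pi; have := eint_inf_le (Pi : [set i | ~ zero_module (P i)] i).
have := eint_sup_ge (Pi : [set i | ~ zero_module (P i)] i).
rewrite /bounded_below /bounded -/(cpx_sup P) -/(cpx_inf P).
by case: (cpx_sup P) => [s| |] //; [exists s | case: (cpx_inf P)].
Qed.

End Complexes.

Theorem theorem1p2 (R : comPzRingType) (M : lmodType R) :
  noetherian R -> finitely_generated M -> ~ zero_module M ->
  (grade M <= qpd M)%E.
Proof.
move=> _ _ Mn0; apply: infimum_ge; last exact: leey.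
move=> _ [P [[Pbelow Pproj [a [Pa [i0 i0inf ai0]]]] Pbounded ->]].
have PH i : ~ zero_module (cpx_homology P i) -> ~ zero_module (P i).
  by move=> Hi Pi; apply/Hi/homology_target_zero.
(* A nonzero exponent [a i0] gives a copy of [M] in the homology, so [hsup P] is not [-oo]. *)
have Hi0 : ~ zero_module (cpx_homology P i0).
  move/(isomorphic_zero (isomorphic_sym (Pa i0 i0inf))) => Z.
  apply: Mn0 => x; case: (a i0) ai0 Z => // k _ Z.
  by have /ffunP/(_ ord0) := Z [ffun=> x]; rewrite !ffunE.
have [s Ps] := bounded_cpx_sup (PH _ Hi0) Pbelow Pbounded.
have le_s i : ~ zero_module (P i) -> i <= s.
  by move=> Pi; rewrite -lee_fin -Ps; exact: eint_sup_ge.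
have [||h Hh hmax] := @int_bounded_max [set i | ~ zero_module (cpx_homology P i)].
- by exists i0.
- by exists s => i /PH/le_s.
have -> : cpx_hsup P = h%:E by exact: eint_sup_max.
have hs : h <= s by exact/le_s/PH.
(* This puts [h] in the range where the homology of [P] is a power of [M]. *)
have hinf : (cpx_inf P <= h%:E)%E by apply: eint_inf_le; exact: PH.
have [||||i i_le Ei] := @Ext_nonvanishing R M P h (s - h) Mn0 Pproj.
- move=> i hi; apply: contrapT => Hi.
  by have := hmax i Hi; rewrite leNgt hi.
- by move=> i; rewrite addrC subrK => si; apply: contrapT => /le_s; rewrite leNgt si.
- by rewrite subr_ge0.
- exact: isomorphic_power_embedding Hh (Pa h hinf).
rewrite Ps -EFinB; apply: (@le_trans _ _ i%:Z%:E); last by rewrite lee_fin.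
by apply: eint_inf_le; exists i.
Qed.
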